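(* Let $(F,A)_Q$ be a distributive soft quasigroup. Then: (1) $(F,A)_Q\cong\left({}_xF^\lambda,A\right)_Q\cong\left(F_x^\rho,A\right)_Q$ for any fixed $x\in Q$. Furthermore, $\left(F_Q^\rho,A\right)\cong\left(F_Q^\lambda,A\right)$. (2) If $(F,A)_Q$ is a normal soft quasigroup, then $\left(F_Q^\rho,A\right)=\left\{\left(F_x^\rho,A\right)_Q\right\}_{x\in Q}$ and $\left(F_Q^\lambda,A\right)=\left\{\left({}_xF^\lambda,A\right)_Q\right\}_{x\in Q}$ are isomorphic families of normal soft quasigroups.
   Context: A quasigroup is a nonempty set $Q$ with a binary operation $\cdot$ such that for all $a,b\in Q$ each of the equations $a\cdot x=b$ and $y\cdot a=b$ has a unique solution in $Q$; juxtaposition denotes the operation. A nonempty subset $H\subseteq Q$ is a subquasigroup ($H\le Q$) if it is closed under the operation and is a quasigroup under it. $Q$ is distributive if $x(yz)=(xy)(xz)$ and $(yz)x=(yx)(zx)$ for all $x,y,z\in Q$. An equivalence relation $\theta$ on $Q$ is a normal congruence if for all $a,b,c,d\in Q$: $ca\,\theta\, cb\Rightarrow a\,\theta\, b$; $ac\,\theta\, bc\Rightarrow a\,\theta\, b$; and $a\,\theta\, b$, $c\,\theta\, d\Rightarrow ac\,\theta\, bd$. A subquasigroup $H$ of $Q$ is normal ($H\lhd Q$) if it is an equivalence class of some normal congruence on $Q$. A soft set $(F,A)$ over $Q$ consists of a set $A$ of parameters and a map $F:A\to 2^{Q}\setminus\{\emptyset\}$. It is a soft quasigroup $(F,A)_Q$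 over $Q$ if $F(a)\le Q$ for all $a\in A$; it is a distributive soft quasigroup if in addition $Q$ is a distributive quasigroup; it is a normal soft quasigroup if $F(a)\lhd Q$ for all $a\in A$. For $x\in Q$, the $x$-right coset soft set $(F_x^\rho,A)$ is the soft set $a\mapsto F_x(a)=F(a)\cdot x=\{hx:h\in F(a)\}$, and the $x$-left coset soft set $({}_xF^\lambda,A)$ is the soft set $a\mapsto {}_xF(a)=x\cdot F(a)=\{xh:h\in F(a)\}$. The right coset of $(F,A)_Q$ is the family $(F_Q^\rho,A)=\{(F_x^\rho,A)_Q\}_{x\in Q}$ and the left coset is the family $(F_Q^\lambda,A)=\{({}_xF^\lambda,A)_Q\}_{x\in Q}$. Two soft quasigroups $(F,A)_Q$ and $(G,A)_Q$ are isomorphic, $(F,A)_Q\cong(G,A)_Q$, if $F(a)\cong G(a)$ (as quasigroups) for all $a\in A$. Isomorphism of the two families, $(F_Q^\rho,A)\cong(F_Q^\lambda,A)$, means $(F_x^\rho,A)_Q\cong({}_xF^\lambda,A)_Q$ for every $x\in Q$. *)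

(* Defs.v *)
From HB Require Import structures.
From Corelib Require Import Relation_Definitions.
From mathcomp Require Import all_boot.
From mathcomp Require Import boolp classical_sets functions.

Set Implicit Arguments.
Unset Strict Implicit.
Unset Printing Implicit Defensive.

Local Open Scope classical_set_scope.
Local Open Scope group_scope.

HB.mixin Record Magma_isQuasigroup Q of Magma Q := {
  quasigroup_inhabited : inhabited Q;
  quasigroup_ldiv : forall a b : Q, exists! x : Q, a * x = b;
  quasigroup_rdiv : forall a b : Q, exists! y : Q, y * a = b
}.

#[short(type="quasigroupType")]
HB.structure Definition Quasigroup := {Q of Magma_isQuasigroup Q & Magma Q}.

(* The unique solvability conditions are those of a quasigroup, relativized to
   H: solutions are sought, and unique, in H. *)
Record subquasigroup (Q : quasigroupType) (H : set Q) : Prop := {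
  subquasigroup_neq0 : H !=set0;
  subquasigroup_mul : forall a b, H a -> H b -> H (a * b);
  subquasigroup_ldiv : forall a b, H a -> H b -> exists! x, H x /\ a * x = b;
  subquasigroup_rdiv : forall a b, H a -> H b -> exists! y, H y /\ y * a = b
}.

Definition distributive_quasigroup (Q : quasigroupType) : Prop :=
  forall x y z : Q,
    x * (y * z) = (x * y) * (x * z) /\ (y * z) * x = (y * x) * (z * x).

Record normal_congruence (Q : quasigroupType) (theta : relation Q) : Prop := {
  normal_congruence_equiv : equivalence Q theta;
  normal_congruence_lcancel :
    forall a b c, theta (c * a) (c * b) -> theta a b;
  normal_congruence_rcancel :
    forall a b c, theta (a * c) (b * c) -> theta a b;
  normal_congruence_mul :
    forall a b c d, theta a b -> theta c d -> theta (a * c) (b * d)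
}.

Definition normal_subquasigroup (Q : quasigroupType) (H : set Q) : Prop :=
  subquasigroup H /\
  exists theta : relation Q,
    normal_congruence theta /\ exists a : Q, H = [set b | theta a b].

(* H and K are isomorphic for the induced operations. An isomorphism is encoded
   as a map on all of Q, whose values outside of H are irrelevant. *)
Definition quasigroup_isog (Q : quasigroupType) (H K : set Q) : Prop :=
  exists f : Q -> Q,
    set_bij H K f /\ forall x y, H x -> H y -> f (x * y) = f x * f y.

Record soft_set (A Q : Type) := SoftSet {
  soft_map :> A -> set Q;
  soft_map_neq0 : forall a, soft_map a !=set0
}.

Section SoftQuasigroups.
Variables (A : Type) (Q : quasigroupType).
Implicit Types F G : soft_set A Q.

Definition soft_quasigroup F : Prop := forall a, subquasigroup (F a).

Definition distributive_soft_quasigroup F : Prop :=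
  soft_quasigroup F /\ distributive_quasigroup Q.

Definition normal_soft_quasigroup F : Prop :=
  soft_quasigroup F /\ forall a, normal_subquasigroup (F a).

(* Being soft quasigroups is part of the relation: isomorphism is only
   meaningful between soft quasigroups. *)
Definition soft_isog F G : Prop :=
  [/\ soft_quasigroup F, soft_quasigroup G
    & forall a, quasigroup_isog (F a) (G a)].

Lemma soft_image_neq0 F (f : Q -> Q) a : f @` F a !=set0.
Proof. by have [h Fh] := soft_map_neq0 F a; exists (f h); exists h. Qed.

Definition soft_rcoset F (x : Q) : soft_set A Q :=
  SoftSet (soft_image_neq0 F (fun h => h * x)).

Definition soft_lcoset (x : Q) F : soft_set A Q :=
  SoftSet (soft_image_neq0 F (fun h => x * h)).

Definition right_coset F : Q -> soft_set A Q := fun x => soft_rcoset F x.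

Definition left_coset F : Q -> soft_set A Q := fun x => soft_lcoset x F.

Definition family_isog (FF GG : Q -> soft_set A Q) : Prop :=
  forall x, soft_isog (FF x) (GG x).

End SoftQuasigroups.

(* Main.v *)
Require Import Defs.
From Corelib Require Import Relation_Definitions.
From mathcomp Require Import all_boot.
From mathcomp Require Import boolp classical_sets functions.

(** In a distributive quasigroup, the two distributive laws say exactly that
    every left translation [y |-> x * y] and every right translation
    [y |-> y * x] is multiplicative, and unique divisibility makes translations
    bijective; so they are automorphisms of [Q] ([automorphism_mulgl],
    [automorphism_mulgr]). Hence the coset soft sets [x * F a] and [F a * x]
    are images of [F a] under automorphisms of [Q], just as [F a] is its own
    image under the identity. All claims then come from three facts about
    an automorphism [f] and a subset [H]: [f] maps subquasigroups to
    subquasigroups ([subquasigroup_image]); it maps normal subquasigroups to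
    normal ones, by transporting the congruence along [f]
    ([normal_subquasigroup_image]); and the images of [H] under two
    automorphisms [f] and [g] are isomorphic through the restriction of [g]
    composed with the inverse of [f] ([quasigroup_isog_images]). *)

Set Implicit Arguments.
Unset Strict Implicit.
Unset Printing Implicit Defensive.

Local Open Scope classical_set_scope.
Local Open Scope group_scope.

Definition automorphism (Q : quasigroupType) (f : Q -> Q) : Prop :=
  bijective f /\ {morph f : x y / x * y}.

Section Automorphisms.
Variable Q : quasigroupType.
Implicit Types (f g : Q -> Q) (H : set Q) (x : Q).

Lemma automorphism_id : automorphism (@id Q).
Proof. by split => //; exists id. Qed.

Lemma exists_unique_bijective (S T : Type) (f : S -> T) :
  (forall b, exists! a, f a = b) -> bijective f.
Proof.
move=> fP; have [g gP] := choice (fun b => fP b).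
exists g => [a|b]; last by have [] := gP b.
by have [_] := gP (f a); apply.
Qed.

Lemma automorphism_mulgl (dQ : distributive_quasigroup Q) x :
  automorphism (fun y => x * y).
Proof.
split; first by apply: exists_unique_bijective => b; exact: quasigroup_ldiv.
by move=> y z; have [-> _] := dQ x y z.
Qed.

Lemma automorphism_mulgr (dQ : distributive_quasigroup Q) x :
  automorphism (fun y => y * x).
Proof.
split; first by apply: exists_unique_bijective => b; exact: quasigroup_rdiv.
by move=> y z; have [_ ->] := dQ x y z.
Qed.

Lemma morph_inverse f g : cancel f g -> cancel g f ->
  {morph f : x y / x * y} -> {morph g : x y / x * y}.
Proof. by move=> fK gK fM x y; apply: (can_inj fK); rewrite fM !gK. Qed.

Lemma subquasigroup_image f H :
  automorphism f -> subquasigroup H -> subquasigroup (f @` H).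
Proof.
move=> [/bij_inj f_inj fM] [[h Hh] HM Hl Hr]; split.
- by exists (f h); exists h.
- by move=> _ _ [a Ha <-] [b Hb <-]; exists (a * b); [exact: HM|rewrite fM].
- move=> _ _ [a Ha <-] [b Hb <-]; have [c [[Hc acb] cP]] := Hl _ _ Ha Hb.
  exists (f c); split; first by split; [exists c|rewrite -fM acb].
  move=> _ [[d Hd <-]]; rewrite -fM => /f_inj adb.
  by rewrite (cP d).
- move=> _ _ [a Ha <-] [b Hb <-]; have [c [[Hc cab] cP]] := Hr _ _ Ha Hb.
  exists (f c); split; first by split; [exists c|rewrite -fM cab].
  move=> _ [[d Hd <-]]; rewrite -fM => /f_inj dab.
  by rewrite (cP d).
Qed.

Lemma normal_congruence_preimage g (theta : relation Q) :
  {morph g : x y / x * y} -> normal_congruence theta ->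
  normal_congruence (fun a b => theta (g a) (g b)).
Proof.
move=> gM [[refl_th trans_th sym_th] thl thr thM]; split.
- by split=> [a|a b c|a b]; [exact: refl_th|exact: trans_th|exact: sym_th].
- by move=> a b c; rewrite !gM; exact: thl.
- by move=> a b c; rewrite !gM; exact: thr.
- by move=> a b c d; rewrite !gM; exact: thM.
Qed.

(** If [H] is the [theta]-class of [a], then [f @` H] is the class of [f a] for
    the pullback of [theta] along the inverse of [f]. *)
Lemma normal_subquasigroup_image f H :
  automorphism f -> normal_subquasigroup H -> normal_subquasigroup (f @` H).
Proof.
move=> fA [sH [theta [nth [a defH]]]]; split; first exact: subquasigroup_image.
have [[g fK gK] fM] := fA.
exists (fun b c => theta (g b) (g c)); split.
  exact/normal_congruence_preimage/nth/(morph_inverse fK gK).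
exists (f a); rewrite defH; apply/seteqP; split=> [_ [b ab <-]|b /=].
  by rewrite /= !fK.
by rewrite fK => agb; exists (g b).
Qed.

Lemma quasigroup_isog_images f g H : automorphism f -> automorphism g ->
  quasigroup_isog (f @` H) (g @` H).
Proof.
move=> [[f' fK f'K] fM] [/bij_inj g_inj gM]; exists (g \o f'); split.
  split=> [_ [h Hh <-]|x y _ _ /g_inj/(can_inj f'K)//|_ [h Hh <-]] /=.
    by rewrite fK; exists h.
  by exists (f h); [exists h|rewrite /= fK].
by move=> x y _ _; rewrite /= (morph_inverse fK f'K fM) gM.
Qed.

End Automorphisms.

Lemma soft_isog_images (A : Type) (Q : quasigroupType) (F G K : soft_set A Q)
    (f g : Q -> Q) :
  soft_quasigroup F -> automorphism f -> automorphism g ->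
  (forall a, G a = f @` F a) -> (forall a, K a = g @` F a) -> soft_isog G K.
Proof.
move=> sF fA gA defG defK; split=> a; rewrite ?defG ?defK.
- exact: subquasigroup_image.
- exact: subquasigroup_image.
- exact: quasigroup_isog_images.
Qed.

Lemma normal_soft_quasigroup_image (A : Type) (Q : quasigroupType)
    (F G : soft_set A Q) (f : Q -> Q) :
  automorphism f -> (forall a, G a = f @` F a) ->
  normal_soft_quasigroup F -> normal_soft_quasigroup G.
Proof.
move=> fA defG [sF nF]; split=> a; rewrite defG.
  exact: subquasigroup_image.
exact: normal_subquasigroup_image.
Qed.

Theorem theorem3p4 (A : Type) (Q : quasigroupType) (F : soft_set A Q)
    (hF : distributive_soft_quasigroup F) :
  ((forall x : Q, soft_isog F (soft_lcoset x F) /\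
                  soft_isog (soft_lcoset x F) (soft_rcoset F x)) /\
   family_isog (right_coset F) (left_coset F)) /\
  (normal_soft_quasigroup F ->
     [/\ forall x : Q, normal_soft_quasigroup (right_coset F x),
         forall x : Q, normal_soft_quasigroup (left_coset F x)
       & family_isog (right_coset F) (left_coset F)]).
Proof.
have [sF dQ] := hF.
have lA := automorphism_mulgl dQ; have rA := automorphism_mulgr dQ.
have rl_isog : family_isog (right_coset F) (left_coset F).
  by move=> x; exact: (soft_isog_images sF (rA x) (lA x)).
split; first split=> // x.
  split; last exact: (soft_isog_images sF (lA x) (rA x)).
  apply: (soft_isog_images sF (automorphism_id Q) (lA x)) => // a.
  by rewrite image_id.
move=> nF; split=> // x.
- exact: (normal_soft_quasigroup_image (rA x) _ nF).
- exact: (normal_soft_quasigroup_image (lA x) _ nF).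
Qed.
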